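(* Let $A,B,\mu,\sigma_s^2>0$, $\xi\in(0,1)$, $\theta\in(0,1)$, let $\mathbf{h}\in\mathbb{C}^{1\times N_T}$ and $h_s\in\mathbb{C}$ be nonzero, let $\rho_e^{\mathrm{opt}}\ge 0$ be a constant not depending on $\lambda$, and set $$C=\frac{\theta\|\mathbf{h}\|^4}{2A},\quad D=\frac{\theta B\|\mathbf{h}\|^2}{4A},\quad a=\mu(1-\theta),\quad d=\frac{\xi|h_s|^2}{(1-\theta)\sigma_s^2}.$$ Then the optimal solution of the problem $$\max_{\lambda\ge 0}\ U_L(\lambda)=a\left[\log\left(1+d(\lambda C-2D)\right)-\log\left(1+\rho_e^{\mathrm{opt}}\right)\right]-\lambda^2C+2\lambda D,$$ where $\lambda$ ranges over those $\lambda\ge 0$ for which $1+d(\lambda C-2D)>0$, is $$\lambda^{\mathrm{opt}}=\frac{-(1-3dD)+\sqrt{(1-dD)^2+2ad^2C}}{2dC}.$$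
   Context: $\log$ is the natural logarithm and $\|\cdot\|$ is the Euclidean norm. Interpretation: $U_L$ is the utility of a device transmitter (leader) as a function of the energy price $\lambda$ it offers, for a fixed energy transfer time fraction $\theta$, after substituting the base station's power response $\frac{\lambda\|\mathbf{h}\|^2-B}{2A}$; $\rho_e^{\mathrm{opt}}$ is the eavesdroppers' SNR threshold, which for given $\theta$ does not depend on $\lambda$. *)

(* Defs.v *)
From HB Require Import structures.
From mathcomp Require Import all_boot all_order all_algebra.
From mathcomp Require Import all_classical all_reals all_analysis.
From mathcomp Require Import complex.
Set Implicit Arguments.
Unset Strict Implicit.
Unset Printing Implicit Defensive.
Import Order.TTheory GRing.Theory Num.Theory.
Import numFieldNormedType.Exports.
Local Open Scope classical_set_scope.
Local Open Scope ring_scope.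

(* The norm that MathComp-Analysis puts on matrices is the sup norm, hence
   this separate definition of the Euclidean norm; [Normc.normc] is the
   modulus as an element of [R] (the generic [`|z|] lives in [R[i]]). *)
Definition enorm (R : realType) (n : nat) (h : 'rV[complex R]_n) : R :=
  Num.sqrt (\sum_(j < n) Normc.normc (h ord0 j) ^+ 2).

Definition optimal_solution (R : realType) (S : set R) (f : R -> R) (x : R) :
    Prop :=
  S x /\ forall y : R, S y -> f y <= f x.

(* Main.v *)
(* With [t = 1 + d (lambda C - 2 D)] the stationarity equation of [U_L] becomes
   [2 t^2 - 2 (1 - d D) t = a d^2 C], whose positive root gives [lambda_opt].
   The tangent bound [ln y - ln x <= (y - x) / x] then cancels the first-order
   terms and leaves [U_L y <= U_L lambda_opt - C (y - lambda_opt)^2], which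
   yields optimality and uniqueness at once. *)
Require Import Defs.
From HB Require Import structures.
From mathcomp Require Import all_boot all_order all_algebra.
From mathcomp Require Import all_classical all_reals all_analysis.
From mathcomp Require Import complex ring lra.
Set Implicit Arguments.
Unset Strict Implicit.
Unset Printing Implicit Defensive.
Import Order.TTheory GRing.Theory Num.Theory.
Import numFieldNormedType.Exports.
Local Open Scope classical_set_scope.
Local Open Scope ring_scope.

Lemma normc_gt0 (R : rcfType) (z : complex R) (z_neq0 : z != 0) :
  0 < Normc.normc z.
Proof.
rewrite lt_neqAle eq_sym; apply/andP; split.
  by apply: contra z_neq0 => /eqP/Normc.eq0_normc ->.
by case: z {z_neq0} => x y; exact: sqrtr_ge0.
Qed.

Lemma enorm_gt0 (R : realType) (n : nat) (h : 'rV[complex R]_n)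
  (h_neq0 : h != 0) : 0 < enorm h.
Proof.
have [i hi] : exists i, h ord0 i != 0 by apply/rV0Pn.
rewrite sqrtr_gt0 (bigD1 i)//= ltr_pwDl ?exprn_gt0 ?normc_gt0//.
by apply: sumr_ge0 => j _; exact: sqr_ge0.
Qed.

(** Concavity of [ln], in the form [ln (1 + u) <= u] taken at [u = y / x - 1]. *)
Lemma ln_tangent (R : realType) (x y : R) (x_gt0 : 0 < x) (y_gt0 : 0 < y) :
  ln y - ln x <= (y - x) / x.
Proof.
have yx_gt0 : 0 < y / x by rewrite divr_gt0.
rewrite -ln_div ?posrE// mulrBl divff ?gt_eqF//.
rewrite -[X in ln X](subrK 1) addrC; apply: le_ln1Dx.
by rewrite ltrBDr addNr.
Qed.

(** The channel data enter only through the signs of [a], [d], [C], [D]; [c] stands for the constant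
    logarithm of the eavesdroppers' term. *)
Lemma log_quadratic_maximizer (R : realType) (a d C D : R)
    (a_gt0 : 0 < a) (d_gt0 : 0 < d) (C_gt0 : 0 < C) (D_gt0 : 0 < D) (c : R) :
  let U (x : R) :=
    a * (ln (1 + d * (x * C - 2 * D)) - c) - x ^+ 2 * C + 2 * x * D in
  let S := [set x : R | 0 <= x /\ 0 < 1 + d * (x * C - 2 * D)] in
  let x0 := (- (1 - 3 * d * D)
    + Num.sqrt ((1 - d * D) ^+ 2 + 2 * a * d ^+ 2 * C)) / (2 * d * C) in
  S x0 /\ forall y, S y -> U y <= U x0 - C * (y - x0) ^+ 2.
Proof.
move=> U S; set s := Num.sqrt _; set x0 := _ / _.
have dC_gt0 : 0 < 2 * d * C by rewrite !mulr_gt0.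
have p_gt0 : 0 < 2 * a * d ^+ 2 * C by rewrite !mulr_gt0 ?exprn_gt0.
have s2 : s ^+ 2 = (1 - d * D) ^+ 2 + 2 * a * d ^+ 2 * C.
  by rewrite sqr_sqrtr// addr_ge0 ?sqr_ge0 ?ltW.
(* Both signs of this strict bound are used: [- s < 1 - d * D] makes the argument [t] of the
   logarithm positive, and [1 - d * D < s] makes the numerator of [x0] exceed [2 * d * D]. *)
have s_gt : `|1 - d * D| < s.
  by rewrite -sqrtr_sqr ltr_sqrt ?ltrDl// ltr_pwDr ?sqr_ge0.
have [s_gtN s_gtP] : - s < 1 - d * D /\ 1 - d * D < s.
  by move: s_gt; rewrite ltr_norml => /andP.
have dD_gt0 : 0 < d * D by rewrite mulr_gt0.
have x0C : x0 * (2 * d * C) = - (1 - 3 * d * D) + s.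
  by rewrite divfK ?gt_eqF.
set t := 1 + d * (x0 * C - 2 * D).
have tE : 2 * t = 1 - d * D + s by rewrite /t; lra.
have t_gt0 : 0 < t by lra.
(* This says that the derivative of [U] vanishes at [x0]. Multiplied by [d * t], it becomes the
   quadratic equation in [t], which follows from [s2]. *)
have stationary : a * d * C / t = 2 * C * x0 - 2 * D.
  have quadratic : 2 * t ^+ 2 - 2 * (1 - d * D) * t = a * d ^+ 2 * C.
    have -> : t = (1 - d * D + s) / 2 by lra.
    by field: s2.
  have affine : d * (2 * C * x0 - 2 * D) = 2 * t - 2 + 2 * d * D.
    by rewrite /t; ring.
  apply: (mulfI (lt0r_neq0 d_gt0)); rewrite affine.
  apply: (mulIf (lt0r_neq0 t_gt0)); rewrite -mulrA divfK ?gt_eqF//.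
  transitivity (a * d ^+ 2 * C); first by ring.
  by rewrite -quadratic; ring.
split.
  by split=> //; rewrite /x0 divr_ge0 ?ltW//; lra.
move=> y [_ y_gt0].
set ty := 1 + d * (y * C - 2 * D).
(* Since [ty - t = d * C * (y - x0)], the tangent to the logarithmic term at [x0] has slope
   [a * d * C / t], which [stationary] rewrites. *)
have ln_le : a * (ln ty - ln t) <= (2 * C * x0 - 2 * D) * (y - x0).
  have -> : (2 * C * x0 - 2 * D) * (y - x0) = a * ((ty - t) / t).
    by rewrite -stationary /ty /t; ring.
  by rewrite ler_pM2l// ln_tangent.
rewrite /U -/t -/ty -subr_ge0.
(* The quadratic part of [U] equals its own second-order expansion at [x0], so the slack is exactly
   the gap in [ln_le]. *)
rewrite (_ : _ - _ = (2 * C * x0 - 2 * D) * (y - x0) - a * (ln ty - ln t)).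
  by rewrite subr_ge0.
by ring.
Qed.

Theorem theorem2 (R : realType) (N_T : nat)
    (A B mu sigma_s xi theta rho_e : R)
    (h : 'rV[complex R]_N_T) (h_s : complex R)
    (A_gt0 : 0 < A) (B_gt0 : 0 < B) (mu_gt0 : 0 < mu)
    (sigma_s2_gt0 : 0 < sigma_s ^+ 2)
    (xi_gt0 : 0 < xi) (xi_lt1 : xi < 1)
    (theta_gt0 : 0 < theta) (theta_lt1 : theta < 1)
    (h_neq0 : h != 0) (h_s_neq0 : h_s != 0)
    (rho_e_ge0 : 0 <= rho_e) :
  let C : R := theta * enorm h ^+ 4 / (2 * A) in
  let D : R := theta * B * enorm h ^+ 2 / (4 * A) in
  let a : R := mu * (1 - theta) in
  let d : R :=
    xi * Normc.normc h_s ^+ 2 / ((1 - theta) * sigma_s ^+ 2) in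
  let U_L : R -> R := fun lambda : R =>
    a * (ln (1 + d * (lambda * C - 2 * D)) - ln (1 + rho_e))
      - lambda ^+ 2 * C + 2 * lambda * D in
  let feasible : set R :=
    [set lambda : R | 0 <= lambda /\ 0 < 1 + d * (lambda * C - 2 * D)] in
  let lambda_opt : R :=
    (- (1 - 3 * d * D)
       + Num.sqrt ((1 - d * D) ^+ 2 + 2 * a * d ^+ 2 * C)) / (2 * d * C) in
  forall lambda : R,
    optimal_solution feasible U_L lambda <-> lambda = lambda_opt.
Proof.
move=> C D a d U_L feasible lambda_opt lambda.
have h_gt0 : 0 < enorm h by exact: enorm_gt0.
have theta1_gt0 : 0 < 1 - theta by rewrite subr_gt0.
have hs_gt0 : 0 < Normc.normc h_s by exact: normc_gt0.
have C_gt0 : 0 < C by rewrite !(divr_gt0, mulr_gt0, exprn_gt0).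
have D_gt0 : 0 < D by rewrite !(divr_gt0, mulr_gt0, exprn_gt0).
have a_gt0 : 0 < a by rewrite !(divr_gt0, mulr_gt0, exprn_gt0).
have d_gt0 : 0 < d.
  by rewrite divr_gt0 // mulr_gt0 // exprn_gt0.
have [Sopt Uopt] :=
  log_quadratic_maximizer a_gt0 d_gt0 C_gt0 D_gt0 (ln (1 + rho_e)).
split=> [[Sl maxl]|->].
  (* Uniqueness: another maximizer [lambda] gives [U_L lambda_opt <= U_L lambda_opt - C * (lambda -
     lambda_opt) ^+ 2], so the square is zero. *)
  have := le_trans (maxl _ Sopt) (Uopt _ Sl).
  rewrite lerBrDr gerDl pmulr_rle0// => sq_le0.
  by apply/eqP; rewrite -subr_eq0 -sqrf_eq0 eq_le sq_le0 sqr_ge0.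
split=> // y Sy; apply: le_trans (Uopt y Sy) _.
by rewrite gerBl mulr_ge0 ?sqr_ge0 ?ltW.
Qed.
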